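(* Let $n\ge 1$ be an integer and let $H_1,H_2\in M_n(\mathbb{C})$ satisfy $H_j=H_j^*$ and $\|H_j\|\le 1$ for $j=1,2$. Let $\delta=\|[H_1,H_2]\|_{\mathrm{tr}}$ and suppose $\delta\le 1/16$. Then there exist $A_1,A_2\in M_n(\mathbb{C})$ such that $$\|A_j\|\le 1,\quad A_j=A_j^*,\quad \|H_j-A_j\|_{\mathrm{tr}}\le 2\,\delta^{1/4},\qquad j=1,2,$$ and $[A_1,A_2]=0$. In addition, $A_1$ and $A_2$ can be chosen so that also $[H_1,A_1]=0$.
   Context: $M_n(\mathbb{C})$ is the algebra of complex $n\times n$ matrices, $A^*$ is the conjugate transpose, $[A,B]=AB-BA$, and $\|A\|$ is the operator norm of $A$ acting on $\mathbb{C}^n$ with its standard Hermitian inner product. The normalized Hilbert-Schmidt norm of $A=\{a_{ij}\}_{i,j=1}^n\in M_n(\mathbb{C})$ is defined by $\|A\|_{\mathrm{tr}}^2=\frac1n\sum_{i,j=1}^n|a_{ij}|^2$. *)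

(* Defs.v *)
From mathcomp Require Import all_boot all_order all_algebra.
From mathcomp Require Import classical_sets reals exp.
From mathcomp.real_closed Require Import complex.

Set Implicit Arguments.
Unset Strict Implicit.
Unset Printing Implicit Defensive.

Import Order.TTheory GRing.Theory Num.Theory.
Import ComplexField.Normc.

Local Open Scope classical_set_scope.
Local Open Scope ring_scope.
Local Open Scope complex_scope.

Definition mxcommutator (R : realType) (n : nat) (A B : 'M[R[i]]_n) : 'M[R[i]]_n :=
  A *m B - B *m A.

Definition vnorm (R : realType) (n : nat) (x : 'cV[R[i]]_n) : R :=
  Num.sqrt (\sum_i normc (x i 0) ^+ 2).

(* [sup] is junk on empty or unbounded sets; [has_sup_opnorm] below excludes
   this.  The norm that MathComp-Analysis puts on matrix types is the
   entrywise maximum, hence [vnorm]. *)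
Definition opnorm (R : realType) (n : nat) (A : 'M[R[i]]_n) : R :=
  sup [set vnorm (A *m x) | x in [set x : 'cV[R[i]]_n | vnorm x <= 1]].

Definition trnorm (R : realType) (n : nat) (A : 'M[R[i]]_n) : R :=
  Num.sqrt (n%:R^-1 * \sum_i \sum_j normc (A i j) ^+ 2).

Lemma has_sup_opnorm (R : realType) (n : nat) (A : 'M[R[i]]_n) :
  has_sup [set vnorm (A *m x) | x in [set x : 'cV[R[i]]_n | vnorm x <= 1]].
Proof.
split.
  exists (vnorm (A *m 0)); exists 0 => //=.
  rewrite /vnorm big1 ?sqrtr0 ?ler01 // => i _.
  by rewrite mxE normc0 expr0n.
exists (Num.sqrt (\sum_i (\sum_j normc (A i j)) ^+ 2)).
move=> _ [x /= x1 <-]; rewrite /vnorm ler_wsqrtr // ler_sum // => i _.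
have nn (z : R[i]) : 0 <= normc z by case: z => a b; exact: sqrtr_ge0.
have xj j : normc (x j 0) <= 1.
  apply: le_trans x1; rewrite /vnorm -[leLHS](ger0_norm (nn _)) -sqrtr_sqr.
  rewrite ler_wsqrtr // (bigD1 j) //= lerDl sumr_ge0 // => k _.
  exact: sqr_ge0.
rewrite ler_sqr ?nnegrE ?nn ?sumr_ge0 // mxE.
elim/big_ind2 : _ => [|a b c d ab cd|j _]; first by rewrite normc0.
- by apply: le_trans (lerD ab cd); exact: le_normcD.
- by rewrite normcM ler_piMr.
Qed.

(* Main.v *)
(* Work in an orthonormal eigenbasis of H1, with eigenvalues d_i in [-1, 1], and
   let K be the matrix of H2.  Put t = delta^(1/4).  A grid of mesh w = 2t on the
   line splits the indices into cells; A1 replaces each d_i by a representative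
   eigenvalue of its cell (an error of at most w, keeping |d_i| <= 1 without any
   clipping) and A2 keeps only the entries K_ij with i and j in one cell.  A grid
   shifted at random separates d_i and d_j with probability at most |d_i - d_j|/w,
   so on average the discarded mass is at most
     (1/n) sum |K_ij|^2 |d_i - d_j| / w <= delta / w
   by Cauchy-Schwarz, since (1/n) sum |d_i - d_j|^2 |K_ij|^2 = delta^2; and
   delta / w = t^3 / 2 is well below the required 4 t^2.  The average is taken over
   finitely many shifts (multiples of w/N), at the price of an additive term 1/N. *)
Require Import Defs.
From mathcomp Require Import all_boot all_order all_algebra.
From mathcomp Require Import reals exp.
From mathcomp Require Import ring lra zify.
From mathcomp.real_closed Require Import complex.

Import Order.TTheory GRing.Theory Num.Theory.
Import ComplexField.Normc.

Local Open Scope ring_scope.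
Local Open Scope complex_scope.
Local Open Scope sesquilinear_scope.

(** * Shifted grids on the integers and on the line *)

(** Hermite's identity. Passing from [m] to [m + 1] drops the numerator [m] and adds [m + N + 1],
    whose quotient is larger by exactly one. *)
Lemma sum_divn_shift m N : (\sum_(k < N.+1) (m + k) %/ N.+1 = m)%N.
Proof.
elim: m => [|m IH]; first by rewrite big1 // => k _; rewrite add0n divn_small.
have := @big_ord_recl _ 0%N addn N.+1 (fun k => (m + k) %/ N.+1)%N.
rewrite big_ord_recr /= IH addn0 divnDr // divnn /= => E.
apply/eqP; rewrite -(eqn_add2l (m %/ N.+1)); apply/eqP.
transitivity (m + (m %/ N.+1 + 1))%N; last by lia.
by rewrite E; congr addn; apply: eq_bigr => k _; rewrite addSnnS.
Qed.

(** For [m <= m'] each indicator is at most the difference of the two quotients, and by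
    [sum_divn_shift] these differences add up to [m' - m]. *)
Lemma separating_shifts m m' N :
  (\sum_(k < N.+1) ((m + k) %/ N.+1 != (m' + k) %/ N.+1) <= maxn m m' - minn m m')%N.
Proof.
wlog le_mm' : m m' / (m <= m')%N => [hw|].
  case/orP: (leq_total m m') => /hw //; rewrite maxnC minnC.
  by apply: leq_trans; apply: leq_sum => k _; rewrite eq_sym.
rewrite (maxn_idPr le_mm') (minn_idPl le_mm').
rewrite -[X in (_ <= X - _)%N](sum_divn_shift m' N).
rewrite -[X in (_ <= _ - X)%N](sum_divn_shift m N) -sumnB => [|k _].
  apply: leq_sum => k _; have := leq_div2r N.+1 (leq_add le_mm' (leqnn k)).
  by case: eqP => //=; lia.
exact/leq_div2r/leq_add.
Qed.

(** The cheapest shift costs at most the average over all [N + 1] shifts; after exchanging sums,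
    [h i j] is counted once per shift separating [m i] from [m j]. *)
Lemma exists_cheap_shift {R : realType} {n : nat} (h : 'I_n -> 'I_n -> R)
    (m : 'I_n -> nat) N : (forall i j, 0 <= h i j) ->
  exists k : nat,
    N.+1%:R * (\sum_i \sum_(j | ((m i + k) %/ N.+1 != (m j + k) %/ N.+1)%N) h i j)
    <= \sum_i \sum_j h i j * `|(m i)%:R - (m j)%:R|.
Proof.
move=> h0; pose S (k : 'I_N.+1) :=
  \sum_i \sum_(j | ((m i + k) %/ N.+1 != (m j + k) %/ N.+1)%N) h i j.
case: (@Order.TotalTheory.arg_minP _ _ _ ord0 xpredT S) => // k _ minS.
exists k; apply: (@le_trans _ _ (\sum_k' S k')).
  rewrite mulr_natl -[X in _ *+ X](card_ord N.+1) -sumr_const.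
  by apply: ler_sum => k' _; exact: minS.
rewrite exchange_big /=; apply: ler_sum => i _.
under eq_bigr => k' _ do rewrite big_mkcond /=.
rewrite exchange_big /=; apply: ler_sum => j _.
under eq_bigr => k' _ do rewrite -mulrb -mulr_natr.
rewrite -mulr_sumr -natr_sum ler_wpM2l //.
apply: le_trans (_ : (maxn (m i) (m j) - minn (m i) (m j))%:R <= _).
  by rewrite ler_nat; exact: separating_shifts.
wlog le_ij : i j / (m i <= m j)%N => [hw|].
  case/orP: (leq_total (m i) (m j)) => /hw //.
  by rewrite maxnC minnC distrC.
rewrite (maxn_idPr le_ij) (minn_idPl le_ij) natrB // distrC ger0_norm //.
by rewrite subr_ge0 ler_nat.
Qed.

Lemma truncn_dist {R : realType} (x y : R) : 0 <= x -> 0 <= y ->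
  `|(Num.truncn x)%:R - (Num.truncn y)%:R| <= `|x - y| + 1 :> R.
Proof.
move=> /truncn_itv + /truncn_itv; rewrite -!natr1 => /andP[? ?] /andP[? ?].
have := ler_norm (x - y); have := ler_norm (y - x); rewrite distrC => ? ?.
by rewrite ler_norml; apply/andP; split; lra.
Qed.

(** Discretizes [d] with [N + 1] units per mesh [w]. Truncation changes a distance by at most one
    unit, a fraction [1 / (N + 1) <= eps] of the mesh; this is the source of [eps]. *)
Lemma exists_cheap_partition {R : realType} {n : nat} (h : 'I_n -> 'I_n -> R)
    (d : 'I_n -> R) (b w eps : R) :
  (forall i j, 0 <= h i j) -> (forall i, b <= d i) -> 0 < w -> 0 < eps ->
  exists f : 'I_n -> 'I_n, (forall i, `|d i - d (f i)| <= w) /\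
    \sum_i \sum_(j | f i != f j) h i j
    <= \sum_i \sum_j h i j * (`|d i - d j| / w + eps).
Proof.
move=> h0 bd w0 eps0; pose N := Num.truncn eps^-1.
have N0 : 0 < N.+1%:R :> R by rewrite ltr0n.
have Neps : N.+1%:R^-1 <= eps.
  rewrite -[leRHS]invrK lef_pV2 ?posrE ?invr_gt0 //.
  by rewrite ltW // real_truncnS_gt // num_real.
(* Subtracting [b] keeps [u] nonnegative, where [truncn] is the integer part. *)
pose u i := (d i - b) / (w / N.+1%:R).
have u0 i : 0 <= u i by rewrite !(divr_ge0, subr_ge0) // ltW.
have uB i j : u i - u j = N.+1%:R * ((d i - d j) / w).
  rewrite /u; move: (N.+1%:R) N0 => c c0; field.
  by rewrite !gt_eqF.
pose m i := Num.truncn (u i).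
have [k kP] := exists_cheap_shift h m N h0.
pose cell i := ((m i + k) %/ N.+1)%N.
(* [pick] sees only the extension of the predicate, so [f] is constant on cells. *)
pose f i := odflt i [pick j | cell j == cell i].
have cell_f i : cell (f i) = cell i.
  by rewrite /f; case: pickP => [j /eqP|] //.
have f_cell i j : (f i == f j) = (cell i == cell j).
  apply/eqP/eqP => [eq_f|eq_c]; first by rewrite -cell_f eq_f cell_f.
  rewrite /f (@eq_pick _ _ (fun l => cell l == cell j)) => [|l]; last by rewrite eq_c.
  by case: pickP => // /(_ j); rewrite eqxx.
exists f; split => [i|].
  (* Integers in one cell differ by at most [N]; the fractional parts add less than one, so [u]
     varies by at most [N + 1], which is [w] on the scale of [d]. *)
  have : (`|(m i)%:R - (m (f i))%:R| <= N%:R :> R).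
    have := cell_f i; rewrite /cell => E.
    have := divn_eq (m i + k) N.+1; have := divn_eq (m (f i) + k) N.+1.
    rewrite E; have := ltn_pmod (m i + k) (ltn0Sn N).
    have := ltn_pmod (m (f i) + k) (ltn0Sn N); move: (_ %% _)%N (_ %% _)%N => a c.
    move=> lta ltc Ea Ec.
    have le1 : (m i)%:R <= (m (f i))%:R + N%:R :> R by rewrite -natrD ler_nat; lia.
    have le2 : (m (f i))%:R <= (m i)%:R + N%:R :> R by rewrite -natrD ler_nat; lia.
    by rewrite ler_norml; apply/andP; split; lra.
  have /andP[a1 a2] := truncn_itv (u0 i).
  have /andP[c1 c2] := truncn_itv (u0 (f i)).
  rewrite -/(m i) -/(m (f i)) -!natr1 in a1 a2 c1 c2 * => mN.
  have : `|u i - u (f i)| <= N.+1%:R.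
    by rewrite -natr1; move: mN; rewrite !ler_norml => /andP[? ?]; apply/andP; split; lra.
  rewrite uB normrM (ger0_norm (ltW N0)) ger_pMr // normrM normfV (gtr0_norm w0).
  by rewrite ler_pdivrMr // mul1r.
rewrite -(ler_pM2l N0); under eq_bigr => i _ do under eq_bigl => j do rewrite f_cell.
apply: le_trans kP _; rewrite mulr_sumr; apply: ler_sum => i _.
rewrite mulr_sumr; apply: ler_sum => j _.
rewrite mulrCA ler_wpM2l //; apply: le_trans (truncn_dist _ _ (u0 i) (u0 j)) _.
rewrite uB normrM (ger0_norm (ltW N0)) normrM normfV (gtr0_norm w0) mulrDr lerD2l.
by rewrite -ler_pdivrMl // mulr1.
Qed.

(** * Hilbert-Schmidt norm, contractions and pinching *)

(** Left unnormalized and rectangular so that it also serves as the squared length of column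
    vectors. *)
Definition hsq {R : realType} {m n : nat} (A : 'M[R[i]]_(m, n)) : R :=
  \sum_i \sum_j normc (A i j) ^+ 2.

Definition contraction {R : realType} {n : nat} (A : 'M[R[i]]_n) : Prop :=
  forall x : 'cV[R[i]]_n, hsq (A *m x) <= hsq x.

(** The compression to block-diagonal form, the blocks being the fibres of [f]. *)
Definition pinch {R : realType} {n : nat} (f : 'I_n -> 'I_n) (A : 'M[R[i]]_n) : 'M[R[i]]_n :=
  \matrix_(i, j) (if f i == f j then A i j else 0).

Section Norms.
Variable R : realType.

Lemma conjCE (z : R[i]) : Num.conj z = z^*%C.
Proof. by []. Qed.

Lemma normc_ge0 (z : R[i]) : 0 <= normc z.
Proof. by case: z => a b; exact: sqrtr_ge0. Qed.

Lemma sqr_normcC (z : R[i]) : (normc z ^+ 2)%:C = z * Num.conj z.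
Proof. by rewrite -sqr_normc rmorphXn. Qed.

Lemma normc_real (r : R) : normc r%:C = `|r|.
Proof. by rewrite /normc /= expr0n addr0 sqrtr_sqr. Qed.

Lemma hsq_ge0 m n (A : 'M[R[i]]_(m, n)) : 0 <= hsq A.
Proof. by do 2![apply: sumr_ge0 => ? _]; exact: sqr_ge0. Qed.

(** In trace form, unitary invariance follows from cyclicity. *)
Lemma hsq_trace m n (A : 'M[R[i]]_(m, n)) : (hsq A)%:C = \tr (A *m A ^t* ).
Proof.
rewrite /hsq raddf_sum; apply: eq_bigr => i _; rewrite mxE raddf_sum /=.
by apply: eq_bigr => j _; rewrite sqr_normcC !mxE.
Qed.

Lemma adjmxM m n p (A : 'M[R[i]]_(m, n)) (B : 'M[R[i]]_(n, p)) :
  (A *m B) ^t* = B ^t* *m A ^t*.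
Proof. by rewrite trmx_mul map_mxM. Qed.

Lemma hsq_unitarymxl n p (U : 'M[R[i]]_n) (A : 'M[R[i]]_(n, p)) :
  U \is unitarymx -> hsq (U *m A) = hsq A.
Proof.
move=> Uu; apply: (@complexI R); rewrite !hsq_trace adjmxM -mulmxA mxtrace_mulC.
by rewrite -!mulmxA -invmx_unitary // mulVmx ?unitarymx_unit // mulmx1.
Qed.

Lemma hsq_unitarymxr m n (A : 'M[R[i]]_(m, n)) (U : 'M[R[i]]_n) :
  U \is unitarymx -> hsq (A *m U) = hsq A.
Proof.
move=> Uu; apply: (@complexI R); rewrite !hsq_trace adjmxM mulmxA.
by rewrite mulmxtVK.
Qed.

Lemma hsqZ m n (r : R) (A : 'M[R[i]]_(m, n)) : hsq (r%:C *: A) = r ^+ 2 * hsq A.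
Proof.
rewrite /hsq mulr_sumr; apply: eq_bigr => i _; rewrite mulr_sumr.
apply: eq_bigr => j _.
by rewrite mxE normcM normc_real exprMn real_normK ?num_real.
Qed.

Lemma hsq_eq0 m n (A : 'M[R[i]]_(m, n)) : hsq A = 0 -> A = 0.
Proof.
move=> A0; apply/matrixP => i j; rewrite mxE; apply: eq0_normc.
apply/eqP; rewrite -sqrf_eq0; move/eqP: A0.
rewrite psumr_eq0 => [/allP/(_ i)|? _]; last by apply: sumr_ge0 => ? _; exact: sqr_ge0.
rewrite mem_index_enum => /(_ isT) /=.
by rewrite psumr_eq0 => [/allP/(_ j)|? _]; rewrite ?sqr_ge0 // mem_index_enum => /(_ isT).
Qed.

Lemma vnormE n (x : 'cV[R[i]]_n) : vnorm x = Num.sqrt (hsq x).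
Proof. by congr Num.sqrt; apply: eq_bigr => i _; rewrite big_ord1. Qed.

Lemma trnormE n (A : 'M[R[i]]_n) : trnorm A = Num.sqrt (n%:R^-1 * hsq A).
Proof. by []. Qed.

Lemma opnorm_le1P n (A : 'M[R[i]]_n) : opnorm A <= 1 <-> contraction A.
Proof.
split=> [A1 x|cA].
  have [/eqP x0|x0] := eqVneq (hsq x) 0.
    by rewrite (hsq_eq0 _ _ _ (eqP x0)) mulmx0.
  have hx : 0 < hsq x by rewrite lt_def x0 hsq_ge0.
  (* By homogeneity it is enough to test the unit vector in the direction of [x]. *)
  pose r := (Num.sqrt (hsq x))^-1; have r2 : r ^+ 2 = (hsq x)^-1.
    by rewrite exprVn sqr_sqrtr ?hsq_ge0.
  have : vnorm (A *m (r%:C *: x)) <= 1.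
    apply: le_trans A1; apply: sup_upper_bound; first exact: has_sup_opnorm.
    by exists (r%:C *: x) => //=; rewrite vnormE hsqZ r2 mulVf // sqrtr1.
  rewrite vnormE -scalemxAr hsqZ r2 -[leRHS]sqrtr1 ler_sqrt //.
  by rewrite ler_pdivrMl // mulr1.
apply: sup_le_ub => [|_ [x /= x1 <-]]; first exact: (has_sup_opnorm A).1.
by apply: le_trans x1; rewrite !vnormE ler_wsqrtr.
Qed.

Lemma contraction_unitary_conj n (U A : 'M[R[i]]_n) : U \is unitarymx ->
  contraction A -> contraction (U *m A *m U ^t* ).
Proof.
move=> Uu cA x; rewrite -!mulmxA hsq_unitarymxl //; apply: le_trans (cA _) _.
by rewrite hsq_unitarymxl // trmxC_unitary.
Qed.

Lemma contraction_col n (A : 'M[R[i]]_n) j :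
  contraction A -> \sum_i normc (A i j) ^+ 2 <= 1.
Proof.
move=> /(_ (delta_mx j 0)); rewrite -colE /hsq.
under eq_bigr => i _ do rewrite big_ord1 mxE.
move/le_trans; apply; under eq_bigr => i _ do rewrite big_ord1 mxE eqxx andbT.
rewrite (bigD1 j) //= eqxx normc1 expr1n big1 ?addr0 // => i /negPf ->.
by rewrite normc0 expr0n.
Qed.

Lemma contraction_entry n (A : 'M[R[i]]_n) i j : contraction A -> normc (A i j) <= 1.
Proof.
move=> /(contraction_col _ _ j); rewrite (bigD1 i) //= => h.
rewrite -(@ler_sqr _ _ 1) ?nnegrE ?normc_ge0 // expr1n; apply: le_trans h.
by rewrite lerDl sumr_ge0 // => k _; exact: sqr_ge0.
Qed.

Lemma contraction_hsq n (A : 'M[R[i]]_n) : contraction A -> hsq A <= n%:R.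
Proof.
move=> cA; rewrite /hsq exchange_big /= -[leRHS]mulr_natr mul1r.
rewrite -[X in _ <= X%:R](card_ord n) -sumr_const.
by apply: ler_sum => j _; exact: contraction_col.
Qed.

Lemma contraction_diag_mx n (d : 'rV[R[i]]_n) :
  (forall i, normc (d 0 i) <= 1) -> contraction (diag_mx d).
Proof.
move=> d1 x; rewrite mul_diag_mx /hsq; apply: ler_sum => i _; apply: ler_sum => j _.
rewrite mxE normcM exprMn ler_piMl ?sqr_ge0 //.
by rewrite expr_le1 ?normc_ge0.
Qed.

Lemma contraction_pinch n (f : 'I_n -> 'I_n) (A : 'M[R[i]]_n) :
  contraction A -> contraction (pinch f A).
Proof.
(* The rows in cell [c] see only the component [y c] of [x]. *)
move=> cA x; pose y c := \col_i (if f i == c then x i 0 else 0).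
have Ey i : (pinch f A *m x) i 0 = (A *m y (f i)) i 0.
  rewrite !mxE; apply: eq_bigr => j _; rewrite !mxE eq_sym.
  by case: eqP; rewrite ?mul0r ?mulr0.
have Ex : hsq x = \sum_c hsq (y c).
  rewrite /hsq [RHS]exchange_big; apply: eq_bigr => i _.
  rewrite (bigD1 (f i)) //= [X in _ + X]big1 ?addr0 => [|c /negPf fc].
    by rewrite !big_ord1 mxE eqxx.
  by rewrite big_ord1 mxE eq_sym fc normc0 expr0n.
rewrite Ex; apply: le_trans (_ : \sum_c hsq (A *m y c) <= _); last first.
  by apply: ler_sum => c _; exact: cA.
rewrite /hsq [leRHS]exchange_big; apply: ler_sum => i _.
(* Row [i] keeps only the term [c = f i]; the others are nonnegative. *)
rewrite big_ord1 Ey (bigD1 (f i)) //= big_ord1 lerDl.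
by do 2![apply: sumr_ge0 => ? _]; exact: sqr_ge0.
Qed.

End Norms.

(** * Pinching in the eigenbasis *)

Lemma exists_cheap_pinch {R : realType} {n : nat} (d : 'I_n -> R) (K : 'M[R[i]]_n)
    (t : R) : 0 < t -> t <= 1 / 2 -> (forall i, `|d i| <= 1) -> contraction K ->
  \sum_i \sum_j (d i - d j) ^+ 2 * normc (K i j) ^+ 2 <= n%:R * (t ^+ 4) ^+ 2 ->
  exists f : 'I_n -> 'I_n, (forall i, `|d i - d (f i)| <= 2 * t) /\
    hsq (K - pinch f K) <= n%:R * (2 * t) ^+ 2.
Proof.
move=> t0 t_le d1 cK comK.
have h0 i j : 0 <= normc (K i j) ^+ 2 by exact: sqr_ge0.
have dge i : -1 <= d i by have := d1 i; rewrite ler_norml => /andP[].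
have w0 : 0 < 2 * t by rewrite mulr_gt0.
(* Weights [|K_ij|^2], mesh [2 * t] and tolerance [t ^+ 2], which fits in the budget
   [(2 * t) ^+ 2]. *)
have [f [fd fK]] := exists_cheap_partition _ d (-1) _ _ h0 dge w0 (exprn_gt0 2 t0).
exists f; split => //.
have -> : hsq (K - pinch f K) = \sum_i \sum_(j | f i != f j) normc (K i j) ^+ 2.
  apply: eq_bigr => i _; rewrite [RHS]big_mkcond; apply: eq_bigr => j _.
  by rewrite !mxE; case: eqP; rewrite ?subrr ?subr0 ?normc0 ?expr0n.
apply: le_trans fK _.
(* [a] bounds the normalized Hilbert-Schmidt norm of the commutator. With this weight, AM-GM gives
   the same bound as Cauchy-Schwarz. *)
pose a := t ^+ 4; have a0 : 0 < a by rewrite exprn_gt0.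
(* AM-GM: [|x| <= (x ^+ 2 / a + a) / 2] *)
have amgm (x : R) : `|x| <= x ^+ 2 / (2 * a) + a / 2.
  have : 0 <= (`|x| - a) ^+ 2 / (2 * a) by rewrite divr_ge0 ?sqr_ge0 // mulr_ge0 // ltW.
  rewrite -(real_normK (num_real x)); move: `|x| => y.
  suff -> : (y - a) ^+ 2 / (2 * a) = y ^+ 2 / (2 * a) + a / 2 - y by rewrite subr_ge0.
  by field; rewrite gt_eqF.
apply: (@le_trans _ _ (\sum_i \sum_j ((4 * a * t)^-1 * ((d i - d j) ^+ 2 * normc (K i j) ^+ 2)
    + (a / (4 * t) + t ^+ 2) * normc (K i j) ^+ 2))).
  apply: ler_sum => i _; apply: ler_sum => j _.
  apply: le_trans (_ : normc (K i j) ^+ 2 *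
    (((d i - d j) ^+ 2 / (2 * a) + a / 2) / (2 * t) + t ^+ 2) <= _).
    by rewrite ler_wpM2l // lerD2r ler_pM2r ?invr_gt0.
  by rewrite le_eqVlt; apply/orP; left; apply/eqP; field; rewrite !gt_eqF.
under eq_bigr => i _ do rewrite big_split /= -!mulr_sumr.
rewrite big_split /= -!mulr_sumr.
apply: le_trans (_ : (4 * a * t)^-1 * (n%:R * a ^+ 2) + (a / (4 * t) + t ^+ 2) * n%:R <= _).
  apply: lerD; apply: ler_wpM2l => //.
  - by rewrite invr_ge0 !mulr_ge0 // ltW.
  - by rewrite addr_ge0 ?exprn_ge0 ?divr_ge0 ?mulr_ge0 // ltW.
  - exact: contraction_hsq.
have -> : (4 * a * t)^-1 * (n%:R * a ^+ 2) + (a / (4 * t) + t ^+ 2) * n%:R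
    = n%:R * (t ^+ 3 / 2 + t ^+ 2) :> R.
  by rewrite /a; field; rewrite !gt_eqF.
(* Since [t <= 1 / 2], the term [t ^+ 3 / 2] is at most [t ^+ 2 / 4]. *)
by rewrite ler_wpM2l //; nra.
Qed.

(** * Reduction to diagonal [H1] *)

Lemma mxcommutator_diagE {R : realType} {n : nat} (d : 'rV[R[i]]_n) (A : 'M[R[i]]_n) i j :
  mxcommutator (diag_mx d) A i j = (d 0 i - d 0 j) * A i j.
Proof.
by rewrite /mxcommutator mul_diag_mx mul_mx_diag !mxE mulrBl; congr (_ - _); rewrite mulrC.
Qed.

Theorem theorem2 (R : realType) (n : nat) (n_ge1 : (1 <= n)%N)
    (H1 H2 : 'M[R[i]]_n) (delta : R)
    (H1_sa : H1 = H1 ^t*) (H2_sa : H2 = H2 ^t*)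
    (H1_le1 : opnorm H1 <= 1) (H2_le1 : opnorm H2 <= 1)
    (deltaE : delta = trnorm (mxcommutator H1 H2))
    (delta_le : delta <= 1 / 16) :
  exists A1 A2 : 'M[R[i]]_n,
    [/\ opnorm A1 <= 1 /\ opnorm A2 <= 1,
        A1 = A1 ^t* /\ A2 = A2 ^t*,
        trnorm (H1 - A1) <= 2 * delta `^ (1 / 4) /\
        trnorm (H2 - A2) <= 2 * delta `^ (1 / 4),
        mxcommutator A1 A2 = 0
      & mxcommutator H1 A1 = 0].
Proof.
have n0 : 0 < n%:R :> R by rewrite ltr0n.
have delta_ge0 : 0 <= delta by rewrite deltaE sqrtr_ge0.
have delta2 : hsq (mxcommutator H1 H2) = n%:R * delta ^+ 2.
  rewrite deltaE trnormE sqr_sqrtr ?mulr_ge0 ?invr_ge0 ?hsq_ge0 ?ler0n //.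
  by rewrite mulrA divff ?mul1r // gt_eqF.
(* The mesh must be positive, so [delta = 0] is treated apart: the matrices then already commute. *)
have [d0|d_neq0] := eqVneq delta 0.
  have C0 : mxcommutator H1 H2 = 0 by apply: hsq_eq0; rewrite delta2 d0 expr0n mulr0.
  have tr0 (A : 'M[R[i]]_n) : trnorm (A - A) <= 2 * delta `^ (1 / 4).
    rewrite subrr trnormE /hsq big1 => [|i _]; last first.
      by rewrite big1 // => j _; rewrite mxE normc0 expr0n.
    by rewrite mulr0 sqrtr0 mulr_ge0 // powR_ge0.
  by exists H1, H2; split; rewrite // /mxcommutator subrr.
pose t := delta `^ (1 / 4).
have t0 : 0 < t by rewrite powR_gt0 // lt_def d_neq0.
have t4 : t ^+ 4 = delta.
  by rewrite -powR_mulrn ?powR_ge0 // -powRrM div1r mulVf ?powRr1 ?pnatr_eq0.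
have t_le : t <= 1 / 2.
  rewrite leNgt; apply/negP => t_gt.
  have : (1 / 2) ^+ 4 < t ^+ 4 by rewrite ltr_pXn2r ?nnegrE ?(ltW t0) ?divr_ge0.
  by rewrite t4; lra.
pose V := spectralmx H1.
have Vu : V \is unitarymx by exact: spectral_unitarymx.
have VuC : V ^t* \is unitarymx by rewrite trmxC_unitary.
have H1_herm : H1 \is hermsymmx.
  by apply/is_hermitianmxP; rewrite expr0 scale1r.
have /mxOverP d_real := hermitian_spectral_diag_real H1_herm.
have H1E : H1 = V ^t* *m diag_mx (spectral_diag H1) *m V.
  by rewrite -invmx_unitary //; apply/orthomx_spectralP/hermitian_normalmx.
pose d i := complex.Re (spectral_diag H1 0 i).
have dE i : spectral_diag H1 0 i = (d i)%:C by rewrite RRe_real.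
have VtV : V ^t* *m V = 1%:M by rewrite -invmx_unitary // mulVmx ?unitarymx_unit.
pose K := V *m H2 *m V ^t*.
have H2E : H2 = V ^t* *m K *m V.
  by rewrite !mulmxA VtV mul1mx -mulmxA VtV mulmx1.
have DE : V *m H1 *m V ^t* = diag_mx (spectral_diag H1).
  by rewrite [in LHS]H1E !mulmxA (unitarymxP Vu) mul1mx mulmxtVK.
have conjM (A B : 'M[R[i]]_n) :
  (V ^t* *m A *m V) *m (V ^t* *m B *m V) = V ^t* *m (A *m B) *m V.
  by rewrite !mulmxA mulmxtVK.
have hsq_conj (A : 'M[R[i]]_n) : hsq (V ^t* *m A *m V) = hsq A.
  by rewrite hsq_unitarymxr // hsq_unitarymxl.
have mxcommutator_conj (A B : 'M[R[i]]_n) : mxcommutator (V ^t* *m A *m V) (V ^t* *m B *m V)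
    = V ^t* *m mxcommutator A B *m V.
  by rewrite /mxcommutator !conjM mulmxBr mulmxBl.
have conj_sa (A : 'M[R[i]]_n) : A = A ^t* -> V ^t* *m A *m V = (V ^t* *m A *m V) ^t*.
  by move=> A_sa; rewrite !adjmxM trmxCK -A_sa mulmxA.
have conj_le1 (A : 'M[R[i]]_n) : contraction A -> opnorm (V ^t* *m A *m V) <= 1.
  move=> cA; apply/opnorm_le1P; rewrite -[X in _ *m X](trmxCK V).
  exact: contraction_unitary_conj.
have conj_near (A B : 'M[R[i]]_n) : hsq (A - B) <= n%:R * (2 * t) ^+ 2 ->
    trnorm (V ^t* *m A *m V - V ^t* *m B *m V) <= 2 * t.
  move=> AB; rewrite trnormE -mulmxBl -mulmxBr hsq_conj.
  rewrite -[leRHS]ger0_norm ?mulr_ge0 ?(ltW t0) // -sqrtr_sqr ler_wsqrtr //.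
  by rewrite ler_pdivrMl.
have cD : contraction (diag_mx (spectral_diag H1)).
  by rewrite -DE; apply: contraction_unitary_conj => //; apply/opnorm_le1P.
have cK : contraction K by apply: contraction_unitary_conj => //; apply/opnorm_le1P.
have K_sa : K = K ^t* by rewrite !adjmxM trmxCK -H2_sa mulmxA.
clearbody K.
(* Eigenvalues are diagonal entries of the contraction [V *m H1 *m V ^t*]. *)
have d1 i : `|d i| <= 1.
  by have := contraction_entry _ _ _ i i cD; rewrite mxE eqxx mulr1n dE normc_real.
have comK : \sum_i \sum_j (d i - d j) ^+ 2 * normc (K i j) ^+ 2
    <= n%:R * (t ^+ 4) ^+ 2.
  rewrite t4 -delta2 [in leRHS]H1E [in leRHS]H2E mxcommutator_conj hsq_conj le_eqVlt.
  apply/orP; left; apply/eqP; apply: eq_bigr => i _; apply: eq_bigr => j _.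
  by rewrite mxcommutator_diagE !dE -rmorphB normcM normc_real exprMn real_normK ?num_real.
have [f [fd fK]] := exists_cheap_pinch _ _ _ t0 t_le d1 cK comK.
pose B := diag_mx (\row_i (d (f i))%:C).
exists (V ^t* *m B *m V), (V ^t* *m pinch f K *m V).
split.
- split; apply: conj_le1; last exact: contraction_pinch.
  by apply: contraction_diag_mx => i; rewrite mxE normc_real.
- split; apply: conj_sa; apply/matrixP => i j; rewrite !mxE.
    rewrite eq_sym; case: eqP => [->|_]; last by rewrite !mulr0n rmorph0.
    by rewrite !mulr1n conjCE conjc_real.
  by rewrite eq_sym; case: eqP => _; rewrite ?rmorph0 // [in LHS]K_sa !mxE.
(* The bound for [H2] is [fK]; for [H1] the difference is diagonal with [n] entries of modulus at
   most [2 * t]. *)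
- rewrite [in H1 - _]H1E [in H2 - _]H2E; split; apply: conj_near => //.
  rewrite mulr_natl -[X in _ *+ X](card_ord n) -sumr_const.
  apply: ler_sum => i _; rewrite (bigD1 i) //= big1 ?addr0 => [|j ji].
    rewrite !mxE eqxx !mulr1n dE -rmorphB normc_real.
    by rewrite ler_sqr ?nnegrE // mulr_ge0 // ltW.
  by rewrite !mxE eq_sym (negPf ji) !mulr0n subr0 normc0 expr0n.
- rewrite mxcommutator_conj; suff -> : mxcommutator B (pinch f K) = 0 by rewrite mulmx0 mul0mx.
  (* Inside a block the two diagonal entries of [B] agree; outside, the pinched entry is zero. *)
  apply/matrixP => i j; rewrite mxcommutator_diagE !mxE.
  by case: eqP => [->|_]; rewrite ?subrr ?mul0r ?mulr0.
- rewrite [in LHS]H1E mxcommutator_conj.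
  suff -> : mxcommutator (diag_mx (spectral_diag H1)) B = 0 by rewrite mulmx0 mul0mx.
  apply/matrixP => i j; rewrite mxcommutator_diagE !mxE.
  by case: eqP => [->|_]; rewrite ?subrr ?mul0r ?mulr0n ?mulr0.
Qed.
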